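(* Let $A$ be a commutative ring and let $\mathfrak{a} \subseteq A$ be an ideal. The following two conditions are equivalent: (i) The ideal $\mathfrak{a}$ is weakly proregular. (ii) There is a covering sequence $\boldsymbol{s} = (s_1,\ldots,s_n)$ of $A$, such that for every $i$ the ideal $\mathfrak{a}_{s_i} := A_{s_i}\otimes_A\mathfrak{a} \subseteq A_{s_i}$ is weakly proregular.
   Context: Rings are not assumed noetherian. For $s\in A$, $A_s = A[s^{-1}]$ is the localization, and $A_s\otimes_A\mathfrak{a}$ is identified with the ideal of $A_s$ generated by $\mathfrak{a}$. A finite sequence $\boldsymbol{s}=(s_1,\ldots,s_n)$ in $A$ is a covering sequence if $\operatorname{Spec}(A)=\bigcup_i\operatorname{Spec}(A_{s_i})$, equivalently $\sum_i A s_i = A$. Koszul complexes: for $a\in A$, $\operatorname{K}(A;a)$ is the complex $A \xrightarrow{a\cdot} A$ concentrated in degrees $-1, 0$. For $j\ge i$ in $\mathbb{N}$ there is a homomorphism of complexes $\mu_{j,i}:\operatorname{K}(A;a^j)\to \operatorname{K}(A;a^i)$ that is the identity in degree $0$ and multiplication by $a^{j-i}$ in degree $-1$. For a finite sequence $\boldsymbol{a}=(a_1,\ldots,a_n)$ in $A$, $\operatorname{K}(A;\boldsymbol{a}) := \operatorname{K}(A;a_1)\otimes_A\cdots\otimes_A \operatorname{K}(A;a_n)$ and $\boldsymbol{a}^i := (a_1^i,\ldots,a_n^i)$; the $\mu_{j,i}$ induce homomorphisms $\operatorname{K}(A;\boldsymbol{a}^j)\to\operatorname{K}(A;\boldsymbol{a}^i)$,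 making $\{\operatorname{K}(A;\boldsymbol{a}^i)\}_{i\in\mathbb{N}}$ an inverse system. An inverse system of modules $\{N_i\}_{i\in\mathbb{N}}$ is pro-zero if for every $i$ there is some $j\ge i$ such that $N_j\to N_i$ is zero. The sequence $\boldsymbol{a}$ is weakly proregular if for every $q<0$ the inverse system $\{\operatorname{H}^q(\operatorname{K}(A;\boldsymbol{a}^i))\}_{i\in\mathbb{N}}$ is pro-zero. An ideal is weakly proregular if it is generated by some (finite) weakly proregular sequence; in particular such an ideal is finitely generated. *)

(* Defs.v *)
From HB Require Import structures.
From mathcomp Require Import all_boot all_order all_algebra.
From mathcomp Require Import boolp classical_sets ring.

Set Implicit Arguments.
Unset Strict Implicit.
Unset Printing Implicit Defensive.

Import GRing.Theory.

Local Open Scope ring_scope.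
Local Open Scope classical_set_scope.
Local Open Scope quotient_scope.

(* Ideals are Prop-valued sets: MathComp's [idealr] only covers proper ideals. *)
Section Ideals.
Variable A : comPzRingType.

Definition is_ideal (I : set A) : Prop :=
  [/\ I 0, forall x y, I x -> I y -> I (x + y) & forall a x, I x -> I (a * x)].

Definition ideal_gen (S : set A) : set A :=
  [set x | exists n (c y : 'I_n -> A),
     (forall i, S (y i)) /\ x = \sum_(i < n) c i * y i].

Definition covering_sequence (s : seq A) : Prop :=
  ideal_gen [set` s] = setT.

End Ideals.

(* The localization A_s, for s possibly a zero divisor or nilpotent: the pair
   (a, m) encodes the fraction a / s^m. *)
Section Localization.
Variables (A : comPzRingType) (s : A).

Definition loc_eq (x y : A * nat) : bool :=
  `[< exists k, s ^+ k * (x.1 * s ^+ y.2) = s ^+ k * (y.1 * s ^+ x.2) >].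

Lemma loc_eq_refl : reflexive loc_eq.
Proof. by move=> x; apply/asboolP; exists 0%N. Qed.

Lemma loc_eq_sym : symmetric loc_eq.
Proof.
by move=> x y; apply/asboolP/asboolP => -[k kP]; exists k.
Qed.

Lemma loc_eq_trans : transitive loc_eq.
Proof.
move=> [y n] [x m] [z p] /asboolP [k /= kP] /asboolP [l /= lP].
apply/asboolP; exists (k + l + n)%N => /=; rewrite !exprD.
transitivity (s ^+ l * s ^+ p * (s ^+ k * (x * s ^+ n))).
  by ring.
rewrite kP; transitivity (s ^+ k * s ^+ m * (s ^+ l * (y * s ^+ p))).
  by ring.
by rewrite lP; ring.
Qed.

Canonical loc_equiv := EquivRel loc_eq loc_eq_refl loc_eq_sym loc_eq_trans.

Definition loc := {eq_quot loc_eq}.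
HB.instance Definition _ : EqQuotient _ loc_eq loc := EqQuotient.on loc.
HB.instance Definition _ := Choice.on loc.

Lemma loc_eqP (x y : A * nat) :
  reflect (exists k, s ^+ k * (x.1 * s ^+ y.2) = s ^+ k * (y.1 * s ^+ x.2))
          (x == y %[mod loc]).
Proof. by rewrite eqmodE; exact: asboolP. Qed.

Definition loc_addf (x y : A * nat) : A * nat :=
  (x.1 * s ^+ y.2 + y.1 * s ^+ x.2, (x.2 + y.2)%N).
Definition loc_oppf (x : A * nat) : A * nat := (- x.1, x.2).
Definition loc_mulf (x y : A * nat) : A * nat := (x.1 * y.1, (x.2 + y.2)%N).

Definition loc_zero : loc := \pi_loc (0, 0%N).
Definition loc_one : loc := \pi_loc (1, 0%N).
Definition loc_add := lift_op2 loc loc_addf.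
Definition loc_opp := lift_op1 loc loc_oppf.
Definition loc_mul := lift_op2 loc loc_mulf.

Lemma loc_pi_add : {morph \pi : x y / loc_addf x y >-> loc_add x y}.
Proof.
move=> x y; unlock loc_add.
have /loc_eqP[k] : x == repr (\pi_loc x) %[mod loc] by rewrite reprK.
have /loc_eqP[l] : y == repr (\pi_loc y) %[mod loc] by rewrite reprK.
case: (repr (\pi_loc x)) (repr (\pi_loc y)) => [x' m'] [y' n']; case: x y => [x m] [y n] /=.
move=> lP kP; apply/eqP/loc_eqP; exists (k + l)%N => /=.
rewrite !exprD !mulrDl !mulrDr; congr (_ + _).
  transitivity (s ^+ l * s ^+ n * s ^+ n' * (s ^+ k * (x * s ^+ m'))).
    by ring.
  by rewrite kP; ring.
transitivity (s ^+ k * s ^+ m * s ^+ m' * (s ^+ l * (y * s ^+ n'))).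
  by ring.
by rewrite lP; ring.
Qed.
Canonical loc_pi_add_morph := PiMorph2 loc_pi_add.

Lemma loc_pi_opp : {morph \pi : x / loc_oppf x >-> loc_opp x}.
Proof.
move=> x; unlock loc_opp.
have /loc_eqP[k] : x == repr (\pi_loc x) %[mod loc] by rewrite reprK.
move=> kP; apply/eqP/loc_eqP; exists k => /=.
by rewrite !mulNr !mulrN kP.
Qed.
Canonical loc_pi_opp_morph := PiMorph1 loc_pi_opp.

Lemma loc_pi_mul : {morph \pi : x y / loc_mulf x y >-> loc_mul x y}.
Proof.
move=> x y; unlock loc_mul.
have /loc_eqP[k] : x == repr (\pi_loc x) %[mod loc] by rewrite reprK.
have /loc_eqP[l] : y == repr (\pi_loc y) %[mod loc] by rewrite reprK.
case: (repr (\pi_loc x)) (repr (\pi_loc y)) => [x' m'] [y' n']; case: x y => [x m] [y n] /=.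
move=> lP kP; apply/eqP/loc_eqP; exists (k + l)%N => /=; rewrite !exprD.
transitivity (s ^+ k * (x * s ^+ m') * (s ^+ l * (y * s ^+ n'))).
  by ring.
by rewrite kP lP; ring.
Qed.
Canonical loc_pi_mul_morph := PiMorph2 loc_pi_mul.

Lemma loc_addA : associative loc_add.
Proof.
elim/quotW=> x; elim/quotW=> y; elim/quotW=> z; rewrite !piE /loc_addf /=.
by rewrite addnA !exprD; congr (\pi_loc (_, _)); ring.
Qed.

Lemma loc_addC : commutative loc_add.
Proof.
by elim/quotW=> x; elim/quotW=> y; rewrite !piE /loc_addf addrC addnC.
Qed.

Lemma loc_add0 : left_id loc_zero loc_add.
Proof.
elim/quotW=> -[x m]; rewrite /loc_zero -loc_pi_add /loc_addf /=.
by rewrite mul0r add0r mulr1 add0n.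
Qed.

Lemma loc_addN : left_inverse loc_zero loc_opp loc_add.
Proof.
elim/quotW=> -[x m]; rewrite !piE /loc_zero /loc_addf /=; apply/eqP/loc_eqP.
by exists 0%N; rewrite /= mulNr addNr !mul0r.
Qed.

HB.instance Definition _ :=
  GRing.isZmodule.Build loc loc_addA loc_addC loc_add0 loc_addN.

Lemma loc_mulA : associative loc_mul.
Proof.
elim/quotW=> x; elim/quotW=> y; elim/quotW=> z.
by rewrite !piE /loc_mulf /= mulrA addnA.
Qed.

Lemma loc_mulC : commutative loc_mul.
Proof.
by elim/quotW=> x; elim/quotW=> y; rewrite !piE /loc_mulf mulrC addnC.
Qed.

Lemma loc_mul1 : left_id loc_one loc_mul.
Proof.
by elim/quotW=> -[x m]; rewrite /loc_one -loc_pi_mul /loc_mulf /= mul1r add0n.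
Qed.

Lemma loc_mulDl : left_distributive loc_mul loc_add.
Proof.
elim/quotW=> -[x m]; elim/quotW=> -[y n]; elim/quotW=> -[z p].
rewrite !piE /loc_mulf /loc_addf /=; apply/eqP/loc_eqP; exists 0%N => /=.
by rewrite !exprD; ring.
Qed.

HB.instance Definition _ := GRing.Zmodule_isComPzRing.Build loc
  loc_mulA loc_mulC loc_mul1 loc_mulDl.

Definition to_loc (a : A) : loc := \pi_loc (a, 0%N).

Lemma to_loc_zmod : zmod_morphism to_loc.
Proof.
move=> x y; rewrite /to_loc -[X in _ = _ + X]loc_pi_opp -[RHS]loc_pi_add.
by rewrite /loc_addf /loc_oppf /= !mulr1.
Qed.

Lemma to_loc_monoid : monoid_morphism to_loc.
Proof.
by split=> [//|x y]; rewrite /to_loc -[RHS]loc_pi_mul /loc_mulf.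
Qed.

HB.instance Definition _ :=
  GRing.isZmodMorphism.Build A loc to_loc to_loc_zmod.
HB.instance Definition _ :=
  GRing.isMonoidMorphism.Build A loc to_loc to_loc_monoid.

End Localization.

(* The image of A_s \otimes_A I in A_s. *)
Definition loc_ideal (A : comPzRingType) (s : A) (I : set A) : set (loc s) :=
  ideal_gen (to_loc s @` I).
Arguments loc_ideal {A} s I _.

(* Matrices indexed by arbitrary finite types, acting on row vectors. *)
Section Matrices.
Variable A : comPzRingType.

Definition fmul (T U V : finType) (f : T -> U -> A) (g : U -> V -> A)
    (x : T) (z : V) : A :=
  \sum_(y : U) f x y * g y z.

Definition fid (T : finType) (x y : T) : A := (x == y)%:R.

Definition fkron (T T' U U' : finType) (f : T -> T' -> A) (g : U -> U' -> A)
    (x : T * U) (y : T' * U') : A :=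
  f x.1 y.1 * g x.2 y.2.

Lemma fmulDl (T U V : finType) (f f' : T -> U -> A) (g : U -> V -> A) x z :
  fmul (fun x y => f x y + f' x y) g x z = fmul f g x z + fmul f' g x z.
Proof. by rewrite -big_split; apply: eq_bigr => y _; rewrite mulrDl. Qed.

Lemma fmulDr (T U V : finType) (f : T -> U -> A) (g g' : U -> V -> A) x z :
  fmul f (fun x y => g x y + g' x y) x z = fmul f g x z + fmul f g' x z.
Proof. by rewrite -big_split; apply: eq_bigr => y _; rewrite mulrDr. Qed.

Lemma fmul_diagl (T U : finType) (c : T -> A) (g : T -> U -> A) x z :
  fmul (fun x y => c x * fid x y) g x z = c x * g x z.
Proof.
rewrite /fmul (bigD1 x) //= /fid eqxx mulr1 big1 ?addr0 // => y /negbTE.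
by rewrite eq_sym => ->; rewrite mulr0 mul0r.
Qed.

Lemma fmul_diagr (T U : finType) (c : U -> A) (g : T -> U -> A) x z :
  fmul g (fun x y => c x * fid x y) x z = g x z * c z.
Proof.
rewrite /fmul (bigD1 z) //= /fid eqxx mulr1 big1 ?addr0 // => y /negbTE ->.
by rewrite !mulr0.
Qed.

Lemma fmul_idl (T U : finType) (g : T -> U -> A) x z :
  fmul (@fid T) g x z = g x z.
Proof.
rewrite /fmul (bigD1 x) //= /fid eqxx mul1r big1 ?addr0 // => y /negbTE.
by rewrite eq_sym => ->; rewrite mul0r.
Qed.

Lemma fmul_idr (T U : finType) (g : T -> U -> A) x z :
  fmul g (@fid U) x z = g x z.
Proof.
rewrite /fmul (bigD1 z) //= /fid eqxx mulr1 big1 ?addr0 // => y /negbTE ->.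
by rewrite mulr0.
Qed.

Lemma fmul_kron (T T' T'' U U' U'' : finType) (f : T -> T' -> A)
    (f' : T' -> T'' -> A) (g : U -> U' -> A) (g' : U' -> U'' -> A) x z :
  fmul (fkron f g) (fkron f' g') x z = fkron (fmul f f') (fmul g g') x z.
Proof.
rewrite /fmul /fkron /= big_distrlr /= pair_bigA /=.
by apply: eq_bigr => y _; rewrite mulrACA.
Qed.

End Matrices.

(* Bounded complexes of finite free A-modules with a chosen homogeneous basis;
   [diff x y] is the coefficient of y in the differential of x. *)
Record fcomplex (A : comPzRingType) := FComplex {
  basis : finType;
  deg : basis -> int;
  diff : basis -> basis -> A;
  diff_deg : forall x y, diff x y != 0 -> deg y = deg x + 1;
  diffK : forall x z, fmul diff diff x z = 0 }.

(* [hcoef x y] is the coefficient of y in the image of x. *)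
Record fhom (A : comPzRingType) (C D : fcomplex A) := FHom {
  hcoef :> basis C -> basis D -> A;
  hcoef_deg : forall x y, hcoef x y != 0 -> deg y = deg x;
  hcoef_diff : forall x z,
    fmul (@diff A C) hcoef x z = fmul hcoef (@diff A D) x z }.

(* The complex A concentrated in degree 0. *)
Section UnitComplex.
Variable A : comPzRingType.

Lemma unit_diff_deg (x y : unit) : (0 : A) != 0 -> (0 : int) = 0 + 1.
Proof. by rewrite eqxx. Qed.

Lemma unit_diffK (x z : unit) :
  fmul (fun _ _ : unit => 0 : A) (fun _ _ : unit => 0) x z = 0.
Proof. by rewrite /fmul big1 // => y _; rewrite mul0r. Qed.

Definition unit_complex : fcomplex A :=
  @FComplex A unit (fun _ => 0) (fun _ _ => 0) unit_diff_deg unit_diffK.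

Lemma unit_hom_deg (x y : basis unit_complex) :
  fid A x y != 0 -> deg y = deg x.
Proof. by []. Qed.

Lemma unit_hom_diff (x z : basis unit_complex) :
  fmul (@diff A unit_complex) (@fid A _) x z
  = fmul (@fid A _) (@diff A unit_complex) x z.
Proof. by rewrite fmul_idl fmul_idr. Qed.

Definition unit_hom : fhom unit_complex unit_complex :=
  FHom unit_hom_deg unit_hom_diff.

End UnitComplex.

(* The tensor product: basis elements (x, y) stand for x \otimes y, and
   d (x \otimes y) = d x \otimes y + (-1)^(deg x) x \otimes d y. *)
Section Tensor.
Variable A : comPzRingType.

Definition dsign (C : fcomplex A) (x : basis C) : A := (-1) ^+ `|deg x|%N.

Lemma dsignD1 (C : fcomplex A) (x y : basis C) :
  deg y = deg x + 1 -> dsign y = - dsign x.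
Proof.
rewrite /dsign => ->; case: (deg x) => [n|[|n]].
- by rewrite -PoszD absz_nat addn1 exprS mulN1r.
- by rewrite /= expr0 expr1 opprK.
- have -> : Negz n.+1 + 1 = Negz n by rewrite !NegzE -[n.+2]addn1 PoszD opprD addrNK.
  by rewrite /= [in RHS]exprS mulN1r opprK.
Qed.

Section Object.
Variables C D : fcomplex A.

Definition tens_deg (x : basis C * basis D) : int := deg x.1 + deg x.2.

Definition tens_diff (x y : basis C * basis D) : A :=
  fkron (@diff A C) (@fid A _) x y
  + fkron (fun u v => dsign u * fid A u v) (@diff A D) x y.

Lemma tens_diff_deg x y : tens_diff x y != 0 -> tens_deg y = tens_deg x + 1.
Proof.
case: x y => [x x'] [y y']; rewrite /tens_diff /fkron /tens_deg /fid /=.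
case: (eqVneq x' y') => [<-|_]; case: (eqVneq x y) => [<-|_] /=;
  rewrite ?(mulr0, mul0r, addr0, add0r, mulr1) ?eqxx //.
- case: (eqVneq (diff x x) 0) => [->|/diff_deg {1}-> _]; last by rewrite addrAC.
  rewrite add0r; case: (eqVneq (diff x' x') 0) => [->|/diff_deg {1}-> _].
    by rewrite mulr0 eqxx.
  by rewrite addrA.
- by move/diff_deg->; rewrite addrAC.
- case: (eqVneq (diff x' y') 0) => [->|/diff_deg -> _]; last by rewrite addrA.
  by rewrite mulr0 eqxx.
Qed.

Lemma tens_diffK x z : fmul tens_diff tens_diff x z = 0.
Proof.
rewrite fmulDl !fmulDr !fmul_kron /fkron !diffK !fmul_idl !fmul_idr.
rewrite !fmul_diagl !fmul_diagr mul0r mulr0 add0r addr0 -mulrDl.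
case: (eqVneq (diff x.1 z.1) 0) => [->|/diff_deg/dsignD1 ->].
  by rewrite !mul0r mulr0 addr0 mul0r.
by ring.
Qed.

Definition tens : fcomplex A :=
  @FComplex A (basis C * basis D)%type tens_deg tens_diff
    tens_diff_deg tens_diffK.

End Object.

Section Morphism.
Variables (C C' D D' : fcomplex A) (f : fhom C C') (g : fhom D D').

Definition tens_hcoef : basis (tens C D) -> basis (tens C' D') -> A :=
  fkron f g.

Lemma tens_hcoef_deg x y : tens_hcoef x y != 0 -> deg y = deg x.
Proof.
case: x y => [x x'] [y y']; rewrite /tens_hcoef /fkron /= /tens_deg /=.
case: (eqVneq (f x y) 0) => [->|/hcoef_deg ->]; first by rewrite mul0r eqxx.
by case: (eqVneq (g x' y') 0) => [->|/hcoef_deg -> //]; rewrite mulr0 eqxx.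
Qed.

Lemma tens_hcoef_diff x z :
  fmul (@diff A (tens C D)) tens_hcoef x z
  = fmul tens_hcoef (@diff A (tens C' D')) x z.
Proof.
rewrite fmulDl fmulDr !fmul_kron /fkron !hcoef_diff !fmul_idl !fmul_idr.
rewrite fmul_diagl fmul_diagr; congr (_ + _ * _).
case: (eqVneq (f x.1 z.1) 0) => [->|/hcoef_deg fxz].
  by rewrite mulr0 mul0r.
by rewrite /dsign fxz mulrC.
Qed.

Definition tens_hom : fhom (tens C D) (tens C' D') :=
  FHom tens_hcoef_deg tens_hcoef_diff.

End Morphism.
End Tensor.

Section Koszul.
Variable A : comPzRingType.

(* K(A; a): [true] is the basis element in degree -1, [false] in degree 0. *)
Section One.
Variable a : A.

Definition kos1_deg (x : bool) : int := if x then -1 else 0.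
Definition kos1_diff (x y : bool) : A := if x && ~~ y then a else 0.

Lemma kos1_diff_deg x y : kos1_diff x y != 0 -> kos1_deg y = kos1_deg x + 1.
Proof. by case: x y => [] []; rewrite /kos1_diff /= ?eqxx. Qed.

Lemma kos1_diffK x z : fmul kos1_diff kos1_diff x z = 0.
Proof.
rewrite /fmul big_bool /kos1_diff /= andbF /=.
by rewrite mulr0 mul0r addr0.
Qed.

Definition koszul1 : fcomplex A :=
  FComplex kos1_diff_deg kos1_diffK.

End One.

(* mu_{j,i} : K(A; a^j) -> K(A; a^i). *)
Section Mu1.
Variables (a : A) (i j : nat) (ij : (i <= j)%N).

Definition mu1_coef (x : basis (koszul1 (a ^+ j)))
    (y : basis (koszul1 (a ^+ i))) : A :=
  match x, y with
  | true, true => a ^+ (j - i)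
  | false, false => 1
  | _, _ => 0
  end.

Lemma mu1_deg x y : mu1_coef x y != 0 -> deg y = deg x.
Proof. by case: x y => [] []; rewrite /= ?eqxx. Qed.

Lemma mu1_diff x z :
  fmul (@diff A (koszul1 (a ^+ j))) mu1_coef x z
  = fmul mu1_coef (@diff A (koszul1 (a ^+ i))) x z.
Proof.
rewrite /fmul !big_bool /= /kos1_diff; case: x z => [] [] /=;
by rewrite !(mul0r, mulr0, add0r, addr0, mulr1) // -exprD subnK.
Qed.

Definition koszul1_mu : fhom (koszul1 (a ^+ j)) (koszul1 (a ^+ i)) :=
  FHom mu1_deg mu1_diff.

End Mu1.

Fixpoint koszul (s : seq A) : fcomplex A :=
  if s is a :: s' then tens (koszul1 a) (koszul s') else unit_complex A.

Definition seqX (s : seq A) (i : nat) : seq A := [seq a ^+ i | a <- s].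

Fixpoint koszul_mu (s : seq A) (i j : nat) (ij : (i <= j)%N) :
    fhom (koszul (seqX s j)) (koszul (seqX s i)) :=
  match s with
  | [::] => unit_hom A
  | a :: s' => tens_hom (koszul1_mu a ij) (koszul_mu s' ij)
  end.

End Koszul.

Section Cohomology.
Variable A : comPzRingType.
Implicit Types (C D : fcomplex A) (q : int).

Definition cochain C q : zmodType := {ffun {x : basis C | deg x == q} -> A}.

(* The differential C^p -> C^q, which vanishes unless q = p + 1; having both
   degrees as parameters avoids casts between C^q and C^(q - 1 + 1). *)
Definition cdiff C p q (c : cochain C p) : cochain C q :=
  [ffun y => \sum_x c x * diff (val x) (val y)].

Definition cmap C D (f : fhom C D) q (c : cochain C q) : cochain D q :=
  [ffun y => \sum_x c x * f (val x) (val y)].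

Lemma cdiffB C p q : zmod_morphism (@cdiff C p q).
Proof.
move=> b c; apply/ffunP => y; rewrite !ffunE -sumrB.
by apply: eq_bigr => x _; rewrite !ffunE mulrBl.
Qed.

Lemma cmapB C D (f : fhom C D) q : zmod_morphism (@cmap C D f q).
Proof.
move=> b c; apply/ffunP => y; rewrite !ffunE -sumrB.
by apply: eq_bigr => x _; rewrite !ffunE mulrBl.
Qed.

HB.instance Definition _ C (p q : int) :=
  GRing.isZmodMorphism.Build (cochain C p) (cochain C q) (@cdiff C p q)
    (@cdiffB C p q).
HB.instance Definition _ C D (f : fhom C D) (q : int) :=
  GRing.isZmodMorphism.Build (cochain C q) (cochain D q) (@cmap C D f q)
    (@cmapB C D f q).

Lemma sum_deg C q (F : basis C -> A) :
    (forall x, F x != 0 -> deg x = q) ->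
  \sum_(x : {x : basis C | deg x == q}) F (val x) = \sum_x F x.
Proof.
move=> Fq; rewrite [RHS](bigID (fun x => deg x == q)) /=.
rewrite [X in _ + X]big1 ?addr0; last first.
  move=> x; case: (eqVneq (F x) 0) => // /Fq ->; by rewrite eqxx.
rewrite [RHS](reindex_omap (val : {x : basis C | deg x == q} -> _) insub).
  by apply: eq_bigl => -[x dx] /=; rewrite insubT ?dx /= eqxx.
by move=> x dx; rewrite insubT.
Qed.

Lemma cdiffK C q (c : cochain C q) r :
  cdiff r (cdiff (q + 1) c) = 0.
Proof.
apply/ffunP => z; rewrite !ffunE.
under eq_bigr => y _ do rewrite ffunE mulr_suml.
rewrite exchange_big big1 //= => x _.
under eq_bigr => y _ do rewrite -mulrA.
rewrite -mulr_sumr (sum_deg (F := fun y => diff (val x) y * diff y (val z))).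
  by rewrite [X in _ * X](diffK (val x) (val z)) mulr0.
move=> y; case: (eqVneq (diff (val x) y) 0) => [->|/diff_deg -> _].
  by rewrite mul0r eqxx.
by rewrite (eqP (valP x)).
Qed.

Lemma cmap_cdiff C D (f : fhom C D) p q (c : cochain C p) :
  cmap f (cdiff q c) = cdiff q (cmap f c).
Proof.
have [<-|pq] := eqVneq (p + 1) q; last first.
  have d0 E (b : cochain E p) : cdiff q b = 0.
    apply/ffunP => y; rewrite !ffunE big1 // => x _.
    case: (eqVneq (diff (val x) (val y)) 0) => [->|/diff_deg dxy].
      by rewrite mulr0.
    by rewrite -(eqP (valP x)) -dxy (eqP (valP y)) eqxx in pq.
  by rewrite !d0 raddf0.
apply/ffunP => z; rewrite !ffunE.
under eq_bigr => y _ do rewrite ffunE mulr_suml.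
under [RHS]eq_bigr => y _ do rewrite ffunE mulr_suml.
rewrite exchange_big [RHS]exchange_big; apply: eq_bigr => x _ /=.
under eq_bigr => y _ do rewrite -mulrA.
under [RHS]eq_bigr => y _ do rewrite -mulrA.
rewrite -!mulr_sumr; congr (_ * _).
rewrite (sum_deg (F := fun y => diff (val x) y * f y (val z))); last first.
  move=> y; case: (eqVneq (diff (val x) y) 0) => [->|/diff_deg -> _].
    by rewrite mul0r eqxx.
  by rewrite (eqP (valP x)).
rewrite (sum_deg (F := fun y => f (val x) y * diff y (val z))).
  exact: hcoef_diff.
move=> y; case: (eqVneq (f (val x) y) 0) => [->|/hcoef_deg -> _].
  by rewrite mul0r eqxx.
exact/eqP/(valP x).
Qed.

Definition is_cocycle C q : {pred cochain C q} :=
  [pred c | cdiff (q + 1) c == 0].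

Lemma is_cocycle_zmod C q : zmod_closed (@is_cocycle C q).
Proof.
split=> [|b c]; rewrite !inE ?raddf0 // => /eqP b0 /eqP c0.
by rewrite raddfB /= b0 c0 subrr.
Qed.

HB.instance Definition _ C (q : int) :=
  GRing.isZmodClosed.Build (cochain C q) (@is_cocycle C q)
    (@is_cocycle_zmod C q).

Record cocycle C q := Cocycle {
  cocycle_val :> cochain C q;
  cocycleP : cocycle_val \in @is_cocycle C q }.

HB.instance Definition _ C (q : int) := [isSub for @cocycle_val C q].
HB.instance Definition _ C (q : int) := [Choice of cocycle C q by <:].
HB.instance Definition _ C (q : int) :=
  [SubChoice_isSubZmodule of cocycle C q by <:].

Definition is_coboundary C q : {pred cocycle C q} :=
  [pred c : cocycle C q |
    `[< exists b : cochain C (q - 1), cdiff q b = c :> cochain C q >]].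

Lemma is_coboundary_zmod C q : zmod_closed (@is_coboundary C q).
Proof.
split=> [|b c]; first by apply/asboolP; exists 0; exact: raddf0.
move=> /asboolP[b' b'E] /asboolP[c' c'E]; apply/asboolP; exists (b' - c').
by rewrite raddfB /= b'E c'E.
Qed.

HB.instance Definition _ C (q : int) :=
  GRing.isZmodClosed.Build (cocycle C q) (@is_coboundary C q)
    (@is_coboundary_zmod C q).

Definition cohomology C q : zmodType := Quotient.quot (@is_coboundary C q).

Lemma cmap_cocycle C D (f : fhom C D) q (c : cocycle C q) :
  cmap f c \in @is_cocycle D q.
Proof. by rewrite inE -cmap_cdiff (eqP (cocycleP _)) raddf0. Qed.

Definition cocycle_map C D (f : fhom C D) q (c : cocycle C q) : cocycle D q :=
  Cocycle (cmap_cocycle f c).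

Definition cohomology_map C D (f : fhom C D) q (h : cohomology C q) :
    cohomology D q :=
  \pi_(cohomology D q) (cocycle_map f (repr h)).

Lemma cohomology_mapE C D (f : fhom C D) q (c : cocycle C q) :
  cohomology_map f (\pi_(cohomology C q) c)
  = \pi_(cohomology D q) (cocycle_map f c).
Proof.
rewrite /cohomology_map; apply/eqP; rewrite -Quotient.idealrBE.
have : repr (\pi_(cohomology C q) c) == c %[mod cohomology C q].
  by rewrite reprK.
rewrite -Quotient.idealrBE => /asboolP[b bE]; apply/asboolP.
exists (cmap f b); rewrite -cmap_cdiff bE; exact: raddfB.
Qed.

Lemma cohomology_map_zmod C D (f : fhom C D) q :
  zmod_morphism (@cohomology_map C D f q).
Proof.
elim/quotW=> b; elim/quotW=> c; rewrite -raddfB !cohomology_mapE -raddfB.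
by congr (\pi _); apply: val_inj; exact: raddfB.
Qed.

HB.instance Definition _ C D (f : fhom C D) (q : int) :=
  GRing.isZmodMorphism.Build (cohomology C q) (cohomology D q)
    (@cohomology_map C D f q) (@cohomology_map_zmod C D f q).

End Cohomology.

Section WeakProregularity.

Definition pro_zero (N : nat -> zmodType)
    (tr : forall i j, (i <= j)%N -> {additive N j -> N i}) : Prop :=
  forall i, exists j (ij : (i <= j)%N), forall x : N j, tr i j ij x = 0.

Variable A : comPzRingType.

Definition weakly_proregular_seq (a : seq A) : Prop :=
  forall q : int, q < 0 ->
    pro_zero (N := fun i => cohomology (koszul (seqX a i)) q)
      (fun i j (ij : (i <= j)%N) =>
         @cohomology_map A _ _ (koszul_mu a ij) q
         : {additive cohomology _ q -> cohomology _ q}).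

Definition weakly_proregular (I : set A) : Prop :=
  exists a : seq A, weakly_proregular_seq a /\ I = ideal_gen [set` a].

End WeakProregularity.

(* Main.v *)
Require Import Defs.
From HB Require Import structures.
From mathcomp Require Import all_boot all_order all_algebra.
From mathcomp Require Import boolp classical_sets.

Set Implicit Arguments.
Unset Strict Implicit.
Unset Printing Implicit Defensive.

(* If b lies in the ideal generated by the sequence a, a power of b kills the
   cohomology of K(A; a^i), so that the long exact sequence of the cone
   K(A; b^i, a^i) of b^i on K(A; a^i) shows that a is weakly proregular iff
   (b, a) is. As the Koszul complex is symmetric in its sequence, weak
   proregularity depends only on the ideal. Given (ii), the ideal is finitely
   generated, say by b, and b is weakly proregular in every A_s. For fixed q
   and i, some j works for all the A_s at once: the image in K(A; b^i) of a
   cocycle of K(A; b^j) becomes a coboundary after multiplication by a power of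
   each s, hence is one, because these powers generate the unit ideal. *)

Import GRing.Theory.
Local Open Scope ring_scope.
Local Open Scope quotient_scope.

(** * Ideals, radicals and covering sequences *)

Section Ideals.
Variable A : comPzRingType.
Implicit Types (S J : set A) (s : seq A).

Lemma ideal_gen_ideal S : is_ideal (ideal_gen S).
Proof.
split.
- by exists 0%N, (fun=> 0), (fun=> 0); split=> [[]|]; rewrite ?big_ord0.
- move=> x y [m [c [u [uS ->]]]] [n [d [v [vS ->]]]].
  exists (m + n)%N, (fun i => match split i with inl j => c j | inr j => d j end),
    (fun i => match split i with inl j => u j | inr j => v j end).
  split=> [i|]; first by case: split.
  rewrite big_split_ord /=; congr (_ + _); apply: eq_bigr => i _.
    by rewrite (unsplitK (inl i)).
  by rewrite (unsplitK (inr i)).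
- move=> a x [n [c [u [uS ->]]]]; exists n, (fun i => a * c i), u; split=> //.
  by rewrite mulr_sumr; apply: eq_bigr => i _; rewrite mulrA.
Qed.

Lemma ideal_gen_sub S x : S x -> ideal_gen S x.
Proof.
move=> Sx; exists 1%N, (fun=> 1), (fun=> x); split=> //.
by rewrite big_ord1 mul1r.
Qed.

Lemma ideal_gen_min S J :
  is_ideal J -> (forall x, S x -> J x) -> forall x, ideal_gen S x -> J x.
Proof.
move=> [J0 JD JM] SJ _ [n [c [u [uS ->]]]].
by elim/big_ind: _ => // i _; apply/JM/SJ/uS.
Qed.

Definition radical J : set A := fun x => exists n, J (x ^+ n).

Lemma radical_ideal J : is_ideal J -> is_ideal (radical J).
Proof.
move=> [J0 JD JM]; split; first by exists 1%N.
  move=> x y [m Jx] [n Jy]; exists (m + n)%N; rewrite exprDn.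
  elim/big_ind: _ => // i _; rewrite -mulr_natl; apply: (JM).
  (* Each binomial term has either at least [n] factors [y] or at least [m] factors [x]. *)
  have [ni|/ltnW ni] := leqP n i.
    by rewrite -(subnK ni) exprD mulrA; apply: (JM).
  by rewrite -addnBA // addnC exprD mulrAC; apply: JM.
by move=> a x [n Jx]; exists n; rewrite exprMn; apply: JM.
Qed.

(** The radical of [J] contains the ideal generated by [s], hence 1, and every power of 1 is 1. This
    is the local-to-global principle: [J] will be a set of multipliers for which a property
    holds. *)
Lemma covering_ideal s J : covering_sequence s -> is_ideal J ->
  (forall x, x \in s -> radical J x) -> J 1.
Proof.
move=> sT Ji sJ; have [n] : radical J 1.
  by apply: (ideal_gen_min (radical_ideal Ji) sJ); rewrite sT.
by rewrite expr1n.
Qed.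

End Ideals.

(* The cochains of K(A; s) are built recursively: a pair (x, y) stands for the
   element whose components on [true] (degree -1) and [false] (degree 0) of the
   first tensor factor are x and y. *)
Fixpoint kmod (A : comPzRingType) (n : nat) : lmodType A :=
  if n is n'.+1 then (kmod A n' * kmod A n')%type : lmodType A else A^o.

(** * The inverse system of Koszul complexes on one recursively built module *)

Section KoszulModel.
Variable A : comPzRingType.
Implicit Types (s : seq A) (n i k : nat) (q : int).

Local Notation pair_ := (fun n x y => (x, y) : kmod A n.+1).

Lemma kmod_pairD n (x y x' y' : kmod A n) :
  pair_ n x y + pair_ n x' y' = pair_ n (x + x') (y + y').
Proof. by []. Qed.

Lemma kmod_pairN n (x y : kmod A n) : - pair_ n x y = pair_ n (- x) (- y).
Proof. by []. Qed.

Lemma kmod_pairZ n a (x y : kmod A n) :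
  a *: pair_ n x y = pair_ n (a *: x) (a *: y).
Proof. by []. Qed.

(* The differential of K(A; s^i). *)
Fixpoint kd i s : kmod A (size s) -> kmod A (size s) :=
  match s return kmod A (size s) -> kmod A (size s) with
  | [::] => fun=> 0
  | a :: s' => fun x => pair_ _ (- kd i x.1) (a ^+ i *: x.1 + kd i x.2)
  end.

(* The transition map mu_{i+k,i}, which depends only on k. *)
Fixpoint kmu k s : kmod A (size s) -> kmod A (size s) :=
  match s return kmod A (size s) -> kmod A (size s) with
  | [::] => id
  | a :: s' => fun x => pair_ _ (a ^+ k *: kmu k x.1) (kmu k x.2)
  end.

(* The homogeneous elements of degree q are the fixed points of [kproj q]. *)
Fixpoint kproj q n : kmod A n -> kmod A n :=
  match n return kmod A n -> kmod A n with
  | 0 => fun x => if q == 0 then x else 0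
  | n'.+1 => fun x => pair_ _ (kproj (q + 1) x.1) (kproj q x.2)
  end.

Lemma kd_linear i s : linear (@kd i s).
Proof.
elim: s => [|b s IHs] a; first by move=> x y /=; rewrite scaler0 addr0.
move=> [x y] [x' y']; rewrite kmod_pairZ kmod_pairD /= !IHs kmod_pairZ kmod_pairD.
rewrite scalerN opprD !scalerDr !scalerA mulrC; congr (_, _).
by rewrite addrACA.
Qed.

HB.instance Definition _ i s := GRing.isLinear.Build A _ _ _ _ (@kd_linear i s).

Lemma kmu_linear k s : linear (@kmu k s).
Proof.
elim: s => [|b s IHs] a; first by move=> x y.
move=> [x y] [x' y']; rewrite kmod_pairZ kmod_pairD /= !IHs kmod_pairZ kmod_pairD.
by rewrite scalerDr !scalerA mulrC.
Qed.

HB.instance Definition _ k s := GRing.isLinear.Build A _ _ _ _ (@kmu_linear k s).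

Lemma kproj_linear q n : linear (@kproj q n).
Proof.
elim: n q => [|n IHn] q a.
  by move=> x y /=; case: ifP => //; rewrite scaler0 addr0.
by move=> [x y] [x' y']; rewrite kmod_pairZ kmod_pairD /= !IHn.
Qed.

HB.instance Definition _ q n :=
  GRing.isLinear.Build A _ _ _ _ (@kproj_linear q n).

Lemma kprojK q n (x : kmod A n) : kproj q (kproj q x) = kproj q x.
Proof.
elim: n q x => [|n IHn] q x /=; first by case: (q == 0).
by rewrite !IHn.
Qed.

Lemma kd_kmu i k s (x : kmod A (size s)) :
  kd i (kmu k x) = kmu k (kd (i + k) x).
Proof.
elim: s x => [|a s IHs] x //=; rewrite linearN linearD !linearZ /= !IHs.
by rewrite scalerA -exprD addnC.
Qed.

Lemma kmuD k l s (x : kmod A (size s)) : kmu (k + l) x = kmu k (kmu l x).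
Proof.
elim: s x => [|a s IHs] x //=; rewrite !IHs linearZ /=.
by rewrite scalerA -exprD.
Qed.

Lemma kd_kproj i q s (x : kmod A (size s)) :
  kd i (kproj q x) = kproj (q + 1) (kd i x).
Proof.
elim: s q x => [|a s IHs] q x /=; first by rewrite if_same.
by rewrite !IHs !linearD !linearN linearZ.
Qed.

Lemma kmu_kproj k q s (x : kmod A (size s)) :
  kmu k (kproj q x) = kproj q (kmu k x).
Proof.
elim: s q x => [|a s IHs] q x //=.
by rewrite !IHs linearZ.
Qed.

(** Weak proregularity on the level of cocycles. The primitive [e] carries no degree condition;
    [kd_preim_homog] supplies a homogeneous one where it is needed. *)
Definition kwpr s : Prop :=
  forall q i, q < 0 -> exists k, forall c : kmod A (size s),
    kproj q c = c -> kd (i + k) c = 0 -> exists e, kd i e = kmu k c.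

Lemma kd_preim_homog i q s (x e : kmod A (size s)) :
  kproj (q + 1) x = x -> kd i e = x -> exists2 e', kproj q e' = e' & kd i e' = x.
Proof.
by move=> xq ex; exists (kproj q e); rewrite ?kprojK // kd_kproj ex.
Qed.

Lemma kmu_cocycle i k s (x : kmod A (size s)) :
  kd (i + k) x = 0 -> kd i (kmu k x) = 0.
Proof. by move=> x0; rewrite kd_kmu x0 linear0. Qed.

Lemma linear_packed (U V : lmodType A) (f : U -> V) : linear f ->
  exists g : {linear U -> V}, g =1 f.
Proof.
move=> fl; pose g : {linear U -> V} :=
  HB.pack f (GRing.isLinear.Build A _ _ _ f fl).
by exists g.
Qed.

(* The contracting homotopy of multiplication by an element of the sequence. *)
Lemma kd_homotopy i s a : a \in s ->
  exists h : {linear kmod A (size s) -> kmod A (size s)},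
    forall x, kd i (h x) + h (kd i x) = a ^+ i *: x.
Proof.
elim: s => // b s IHs; rewrite inE; case: (eqVneq a b) => [-> _|_ /= /IHs[h hP]].
  (* For the head of the sequence, the homotopy moves the degree 0 component of the first factor to
     degree -1. *)
  have [|h hE] := @linear_packed (kmod A (size s).+1) (kmod A (size s).+1)
    (fun x => pair_ (size s) x.2 0).
    move=> c [x y] [x' y'] /=.
    by rewrite !kmod_pairZ !kmod_pairD scaler0 addr0.
  exists h => -[x y]; rewrite !hE /=.
  by rewrite linear0 kmod_pairD !addr0 addrCA addNr addr0.
(* A homotopy of the tail extends with a sign on the first component, which cancels the cross terms
   in [b ^+ i]. *)
have [|g gE] := @linear_packed (kmod A (size s).+1) (kmod A (size s).+1)
  (fun x => pair_ (size s) (- h x.1) (h x.2)).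
  move=> c [x y] [x' y'].
  by rewrite !kmod_pairZ !kmod_pairD /= !(linearP h) opprD scalerN.
exists g => -[x y]; rewrite !gE kmod_pairZ -(hP x) -(hP y) /=.
rewrite kmod_pairD; congr (_, _); first by rewrite !linearN /= !opprK.
rewrite linearD linearZ /= scalerN.
by rewrite addrACA addNr add0r.
Qed.

(** The multipliers that turn every cocycle into a coboundary form an ideal, and by [kd_homotopy] it
    contains [a ^+ i] for each [a] in [s]; so its radical contains [b]. *)
Lemma ideal_gen_exp_kills i s b : ideal_gen [set` s]%classic b ->
  exists N, forall k (c : kmod A (size s)), kd i c = 0 ->
    exists e, kd i e = b ^+ (N + k) *: c.
Proof.
pose J : set A := fun t => forall c : kmod A (size s), kd i c = 0 ->
  exists e, kd i e = t *: c.
have Ji : is_ideal J.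
  split=> [c _|x y Jx Jy c c0|a x Jx c c0].
  - by exists 0; rewrite linear0 scale0r.
  - have [[e eP] [f fP]] := (Jx c c0, Jy c c0).
    by exists (e + f); rewrite linearD /= eP fP scalerDl.
  - by have [e eP] := Jx c c0; exists (a *: e); rewrite linearZ /= eP scalerA.
have sJ a : [set` s]%classic a -> radical J a.
  move=> /= sa; exists i => c c0.
  have [h hP] := kd_homotopy i sa.
  by exists (h c); rewrite -hP c0 linear0 addr0.
move=> /(ideal_gen_min (radical_ideal Ji) sJ) [N JN]; exists N => k.
by rewrite addnC exprD; apply: (let: And3 _ _ JM := Ji in JM).
Qed.

(* In the long exact sequence of 0 -> K(s^i) -> K(b^i, s^i) -> K(s^i)[1] -> 0
   the transition maps on the last term are twisted by powers of b, so its
   cohomology is pro-zero in every degree. *)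
Lemma kwpr_cons s b : ideal_gen [set` s]%classic b -> kwpr s <-> kwpr (b :: s).
Proof.
move=> sb; split=> ws q i q0.
  have [k1 k1P] := ws q i q0; have [N NP] := ideal_gen_exp_kills (i + k1) sb.
  exists (k1 + N)%N => -[x y]; rewrite addnA => -[xq yq] [/eqP].
  rewrite oppr_eq0 => /eqP dx dy.
  (* The component [x] has degree [q + 1], possibly 0, where [ws] says nothing. Its image is instead
     killed by [b ^+ N], and a primitive [e] of degree [q] corrects [kmu N y] to a cocycle, to which
     [ws] applies. *)
  have [] := NP 0%N (kmu N x); first exact: kmu_cocycle.
  rewrite addn0 => e0 /(@kd_preim_homog _ q) [|e eq de].
    by rewrite linearZ /= -kmu_kproj xq.
  have [||f fP] := k1P (kmu N y + b ^+ (i + k1) *: e).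
  - by rewrite linearD linearZ /= eq -kmu_kproj yq.
  - rewrite linearD linearZ /= de kd_kmu scalerA -exprD -linearZ -linearD /=.
    by rewrite addrC dy linear0.
  exists (pair_ _ (- (b ^+ k1 *: kmu k1 e)) f) => /=.
  rewrite (linearN (@kd i s)) /= opprK linearZ /= kd_kmu de fP.
  rewrite linearD !linearZ /= !kmuD.
  by rewrite !scalerN !scalerA -!exprD addrCA [(i + k1)%N]addnC addNr addr0 addnC.
(* Conversely, a primitive [(e, f)] of the image of [(0, c)] has [e] a cocycle. The obstruction
   [b ^+ (i + N) *: e] to [f] being a primitive of the image of [c] becomes the coboundary of [g]
   after [N] further steps. *)
have [N NP] := ideal_gen_exp_kills i sb; have [k kP] := ws q (i + N)%N q0.
exists (N + k)%N => c cq; rewrite addnA => dc.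
have [||[e f] /= []] := kP (pair_ _ 0 c).
- by rewrite /= linear0 cq.
- by rewrite /= linear0 oppr0 scaler0 add0r dc.
rewrite !linear0 => /eqP; rewrite oppr_eq0 => /eqP de ef.
have [|g gP] := NP i (kmu N e); first exact: kmu_cocycle.
exists (g + kmu N f); rewrite linearD /= gP kd_kmu kmuD -ef linearD linearZ.
by rewrite addnC.
Qed.

End KoszulModel.

(** * Dependence on the ideal only *)

Section Permutation.
Variable A : comPzRingType.
Implicit Types (s t : seq A) (n i k : nat) (q : int).

(** As [kmod] does not depend on the exponent, a single map gives a morphism of the whole inverse
    system. *)
Definition khom s t (f : kmod A (size s) -> kmod A (size t)) : Prop :=
  [/\ linear f, forall i x, f (kd i x) = kd i (f x),
      forall k x, f (kmu k x) = kmu k (f x) &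
      forall q x, f (kproj q x) = kproj q (f x)].

Definition kretract s t : Prop :=
  exists (f : kmod A (size s) -> kmod A (size t)) g,
    [/\ khom f, khom g & cancel g f].

(** A cocycle is carried along [g], and the primitive found there is carried back along [f]. *)
Lemma kwpr_retract s t : kretract s t -> kwpr s -> kwpr t.
Proof.
move=> [f [g [[fl fd fm fp] [gl gd gm gp] gK]]] ws q i q0.
have [k kP] := ws q i q0; exists k => c cq dc.
have [||e eP] := kP (g c); first by rewrite -gp cq.
  have [G GE] := linear_packed gl.
  by rewrite -gd dc -GE linear0.
by exists (f e); rewrite -fd eP fm gK.
Qed.

Lemma khom_id s : khom (@id (kmod A (size s))).
Proof. by split. Qed.

Lemma khom_comp s t u f g : @khom s t f -> @khom t u g -> @khom s u (g \o f).
Proof.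
move=> [fl fd fm fp] [gl gd gm gp]; split=> [a x y|i x|k x|q x] /=.
- by rewrite fl gl.
- by rewrite fd gd.
- by rewrite fm gm.
- by rewrite fp gp.
Qed.

Lemma kretract_refl s : kretract s s.
Proof. by exists id, id; split; try exact: khom_id. Qed.

Lemma kretract_trans s t u : kretract s t -> kretract t u -> kretract s u.
Proof.
move=> [f [g [fh gh gK]]] [f' [g' [fh' gh' gK']]].
exists (f' \o f), (g \o g'); split; first exact: (khom_comp fh fh').
  exact: (khom_comp gh' gh).
by move=> x /=; rewrite gK gK'.
Qed.

Lemma khom_cons b s t f : @khom s t f ->
  @khom (b :: s) (b :: t) (fun x => (f x.1, f x.2)).
Proof.
move=> [fl fd fm fp]; split=> [a [x y] [x' y']|i [x y]|k [x y]|q [x y]].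
- by rewrite kmod_pairZ !kmod_pairD /= !fl.
- have [F FE] := linear_packed fl.
  by rewrite /= -!FE linearN linearD linearZ /= !FE !fd.
- have [F FE] := linear_packed fl.
  by rewrite /= -!FE linearZ /= !FE !fm.
- by rewrite /= !fp.
Qed.

Lemma kretract_cons b s t : kretract s t -> kretract (b :: s) (b :: t).
Proof.
move=> [f [g [fh gh gK]]]; eexists; eexists; split.
- exact: khom_cons fh.
- exact: khom_cons gh.
- by move=> [x y] /=; rewrite !gK.
Qed.

(** The symmetry of the tensor product with its Koszul sign: exchanging two generators of degree -1
    produces the minus on [z.1.1]. *)
Lemma kretract_swap a b s : kretract [:: a, b & s] [:: b, a & s].
Proof.
pose sw (z : kmod A (size s).+2) : kmod A (size s).+2 :=
  ((- z.1.1, z.2.1), (z.1.2, z.2.2)).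
have swP c d : @khom [:: c, d & s] [:: d, c & s] sw.
  split=> [e [[x1 x2] [x3 x4]] [[y1 y2] [y3 y4]]|i [[x1 x2] [x3 x4]]
    |k [[x1 x2] [x3 x4]]|q [[x1 x2] [x3 x4]]].
  - by rewrite !kmod_pairZ !kmod_pairD /sw /= opprD scalerN.
  - rewrite /sw /= !kmod_pairZ !kmod_pairN !kmod_pairD (linearN (@kd A i s)) /=.
    rewrite !scalerN !opprD !opprK; congr ((_, _), (_, _)).
    by rewrite addrCA.
  - rewrite /sw /= (linearN (@kmu A k s)) /= kmod_pairZ !scalerN !scalerA.
    by rewrite mulrC.
  - rewrite /sw /= (linearN (@kproj A _ _)) /=.
    by [].
exists sw, sw; split=> // -[[x1 x2] [x3 x4]].
by rewrite /sw /= opprK.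
Qed.

Lemma kretract_catC s t : kretract (s ++ t) (t ++ s).
Proof.
have ins a u v : kretract (a :: u ++ v) (u ++ a :: v).
  elim: u => [|b u IHu] /=; first exact: kretract_refl.
  exact/(kretract_trans (kretract_swap _ _ _))/kretract_cons.
elim: s => [|a s IHs] /=; first by rewrite cats0; exact: kretract_refl.
exact/(kretract_trans _ (ins a t s))/kretract_cons.
Qed.

Lemma kwpr_cat s t : (forall b, b \in t -> ideal_gen [set` s]%classic b) ->
  kwpr s <-> kwpr (t ++ s).
Proof.
elim: t => // b t IHt ts.
rewrite IHt => [|c ct]; last by apply: ts; rewrite inE ct orbT.
apply: kwpr_cons; apply: (ideal_gen_min (ideal_gen_ideal _) _ (ts b _)).
  by move=> c /= cs; apply: ideal_gen_sub; rewrite /= mem_cat cs orbT.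
by rewrite inE eqxx.
Qed.

(** The property passes from [s] to [t ++ s], by symmetry to [s ++ t], and down to [t]. *)
Lemma kwpr_ideal s t :
  ideal_gen [set` s]%classic = ideal_gen [set` t]%classic -> kwpr s -> kwpr t.
Proof.
move=> st ws; have [|_] := @kwpr_cat t s.
  by move=> b bs; rewrite -st; apply: ideal_gen_sub.
apply; apply: (kwpr_retract (kretract_catC t s)).
have [|+ _] := @kwpr_cat s t; last exact.
by move=> b bt; rewrite st; apply: ideal_gen_sub.
Qed.

End Permutation.

(** * Comparison with the Koszul complex *)

Section Bridge.
Variable A : comPzRingType.
Implicit Types (s : seq A) (i j k : nat) (q : int).

Fixpoint kvec i s : (basis (koszul (seqX s i)) -> A) -> kmod A (size s) :=
  match s return (basis (koszul (seqX s i)) -> A) -> kmod A (size s) with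
  | [::] => fun c => c tt
  | a :: s' => fun c =>
      (kvec (fun u => c (true, u)), kvec (fun u => c (false, u)))
  end.

Fixpoint kfun i s : kmod A (size s) -> basis (koszul (seqX s i)) -> A :=
  match s return kmod A (size s) -> basis (koszul (seqX s i)) -> A with
  | [::] => fun x _ => x
  | a :: s' => fun x u => if u.1 then kfun x.1 u.2 else kfun x.2 u.2
  end.

Lemma kvecK i s (c : basis (koszul (seqX s i)) -> A) : kfun (kvec c) = c.
Proof.
apply/funext; elim: s c => [|a s IHs] c /=; first by case.
by case=> [[] u] /=; rewrite IHs.
Qed.

Lemma kfunK i s (x : kmod A (size s)) : kvec (@kfun i s x) = x.
Proof. by elim: s x => [|a s IHs] //= -[x y] /=; rewrite !IHs. Qed.

Lemma kvecZD i s a (c d : basis (koszul (seqX s i)) -> A) :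
  kvec (fun u => a * c u + d u) = a *: kvec c + kvec d.
Proof. by elim: s c d => [|b s IHs] c d //=; rewrite !IHs. Qed.

Lemma kvec0 i s : kvec (fun _ : basis (koszul (seqX s i)) => 0) = 0.
Proof. by elim: s => [|b s IHs] //=; rewrite !IHs. Qed.

Lemma kvecZ i s a (c : basis (koszul (seqX s i)) -> A) :
  kvec (fun u => a * c u) = a *: kvec c.
Proof.
rewrite -[RHS]addr0 -(kvec0 i s) -kvecZD.
by congr kvec; apply/funext => u; rewrite addr0.
Qed.

(** The action on vectors of mixed degree, of which [cdiff] and [cmap] are the graded pieces. *)
Definition fapp (C D : fcomplex A) (f : basis C -> basis D -> A)
    (c : basis C -> A) (y : basis D) : A := \sum_x c x * f x y.

Lemma sum_bool_pair (T : finType) (F : bool * T -> A) :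
  \sum_x F x = \sum_v F (true, v) + \sum_v F (false, v).
Proof.
rewrite (eq_bigr (fun x => F (x.1, x.2))) => [|[] //].
by rewrite -(pair_bigA _ (fun b v => F (b, v))) big_bool.
Qed.

Lemma kvec_diff i s (c : basis (koszul (seqX s i)) -> A) :
  kvec (fapp (@diff A _) c) = kd i (kvec c).
Proof.
elim: s c => [|a s IHs] c /=.
  by rewrite /fapp big1 // => x _; rewrite mulr0.
have sumE y : fapp (@diff A (koszul (seqX (a :: s) i))) c y =
    (if y.1 then 0 else a ^+ i * c (true, y.2))
    + (-1) ^+ y.1 * fapp (@diff A (koszul (seqX s i))) (fun u => c (y.1, u)) y.2.
  case: y => y u; rewrite {1}/fapp.
  rewrite [LHS](sum_bool_pair
    (fun x => c x * @diff A (koszul (seqX (a :: s) i)) x (y, u))).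
  (* The two terms of the tensor differential; the sign is -1 exactly on [true], whose degree is
     -1. *)
  have dE b v : diff ((b, v) : basis (koszul (seqX (a :: s) i))) (y, u)
      = kos1_diff (a ^+ i) b y * fid A v u
        + (-1) ^+ b * fid A b y * diff (v : basis (koszul (seqX s i))) u.
    by case: b.
  have idE F : \sum_v F v * fid A v u = F u.
    rewrite (bigD1 u) //= /fid eqxx mulr1 big1 ?addr0 // => v /negbTE ->.
    by rewrite mulr0.
  have sE b F G H : \sum_v c (b, v) * (F * fid A v u + G * H v)
      = F * c (b, u) + G * \sum_v c (b, v) * H v.
    rewrite -(idE (fun v => c (b, v))) !mulr_sumr -big_split /=.
    by apply: eq_bigr => v _; rewrite mulrDr mulrCA [X in _ + X]mulrCA.
  under eq_bigr do rewrite dE; rewrite sE.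
  under [X in _ + X]eq_bigr do rewrite dE; rewrite sE.
  case: y {dE} => /=; rewrite /kos1_diff /fid /=;
  by rewrite ?(mul0r, mulr0, mulr1, add0r, addr0).
rewrite -!IHs; congr (_, _).
  rewrite -scaleN1r -kvecZ; congr kvec; apply/funext => u.
  by rewrite sumE /= add0r expr1.
rewrite -kvecZD; congr kvec; apply/funext => u.
by rewrite sumE /= mul1r.
Qed.

Lemma kvec_mu i j (ij : (i <= j)%N) s (c : basis (koszul (seqX s j)) -> A) :
  kvec (fapp (koszul_mu s ij) c) = kmu (j - i) (kvec c).
Proof.
elim: s c => [|a s IHs] c /=.
  by rewrite /fapp (big_pred1 tt) ?mulr1 //; case.
have sumE y : fapp (koszul_mu (a :: s) ij) c y =
    (if y.1 then a ^+ (j - i) else 1)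
    * fapp (koszul_mu s ij) (fun u => c (y.1, u)) y.2.
  case: y => y u; rewrite /fapp.
  rewrite [LHS](sum_bool_pair (fun x => c x * koszul_mu (a :: s) ij x (y, u))).
  rewrite /= /tens_hcoef /fkron /=.
  by case: y; rewrite mulr_sumr -big_split /=; apply: eq_bigr => v _;
    rewrite !mul0r mulr0 ?addr0 ?add0r mulrCA.
rewrite -!IHs -kvecZ; congr (_, _); congr kvec; apply/funext => u.
  by rewrite sumE.
by rewrite sumE mul1r.
Qed.

Lemma kvec_proj i q s (c : basis (koszul (seqX s i)) -> A) :
  kvec (fun u => if deg u == q then c u else 0) = kproj q (kvec c).
Proof.
elim: s q c => [|a s IHs] q c /=; first by rewrite eq_sym.
rewrite -!IHs; congr (_, _); congr kvec; apply/funext => u.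
  by rewrite /tens_deg /= addrC subr_eq.
by rewrite /tens_deg /= add0r.
Qed.

(** Extension by zero outside degree [q], which turns sums over one degree into sums over the whole
    basis. *)
Definition cext (C : fcomplex A) q (c : cochain C q) (x : basis C) : A :=
  if insub x is Some u then c u else 0.

Lemma cext_val (C : fcomplex A) q (c : cochain C q) x : cext c (val x) = c x.
Proof. by rewrite /cext valK. Qed.

Lemma cext_deg (C : fcomplex A) q (c : cochain C q) x :
  cext c x != 0 -> deg x = q.
Proof. by rewrite /cext; case: insubP => [u /eqP|]; rewrite ?eqxx. Qed.

Lemma cdiff_cext (C : fcomplex A) p q (c : cochain C p) y :
  cdiff q c y = fapp (@diff A C) (cext c) (val y).
Proof.
rewrite ffunE /fapp.
rewrite -(@sum_deg _ _ p (fun x => cext c x * diff x (val y))) => [|x].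
  by apply: eq_bigr => x _; rewrite cext_val.
by case: (eqVneq (cext c x) 0) => [->|/cext_deg //]; rewrite mul0r eqxx.
Qed.

Lemma cmap_cext (C D : fcomplex A) (f : fhom C D) q (c : cochain C q) y :
  cmap f c y = fapp f (cext c) (val y).
Proof.
rewrite ffunE /fapp.
rewrite -(@sum_deg _ _ q (fun x => cext c x * f x (val y))) => [|x].
  by apply: eq_bigr => x _; rewrite cext_val.
by case: (eqVneq (cext c x) 0) => [->|/cext_deg //]; rewrite mul0r eqxx.
Qed.

Lemma cohomology_map0P (C D : fcomplex A) (f : fhom C D) q :
  (forall h : cohomology C q, cohomology_map f h = 0) <->
  (forall c : cochain C q, cdiff (q + 1) c = 0 ->
     exists b : cochain D (q - 1), cdiff q b = cmap f c).
Proof.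
have pi0 (z : cocycle D q) : \pi_(cohomology D q) z = 0 <->
    exists b : cochain D (q - 1), cdiff q b = z :> cochain D q.
  have <- : \pi_(cohomology D q) 0 = 0 by rewrite raddf0.
  split=> [/eqP|zb]; last apply/eqP.
    by rewrite -Quotient.idealrBE subr0 => /asboolP.
  by rewrite -Quotient.idealrBE subr0; apply/asboolP.
split=> [H c c0|H].
  have cP : c \in @is_cocycle _ C q by rewrite inE c0.
  by have /= := H (\pi_(cohomology C q) (Cocycle cP)); rewrite cohomology_mapE => /pi0.
elim/quotW=> c; rewrite cohomology_mapE; apply/pi0/H.
by have := cocycleP c; rewrite inE => /eqP.
Qed.

Lemma kproj_cext i q s (c : cochain (koszul (seqX s i)) q) :
  kproj q (kvec (cext c)) = kvec (cext c).
Proof.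
rewrite -kvec_proj; congr kvec; apply/funext => u.
by case: eqP => // ne; case: (eqVneq (cext c u) 0) => [->|/cext_deg].
Qed.

Lemma cext_kfun i q s (x : kmod A (size s)) : kproj q x = x ->
  cext ([ffun u => kfun x (val u)] : cochain (koszul (seqX s i)) q) = kfun x.
Proof.
move=> xq; apply/funext => u; rewrite /cext; case: insubP => [v _ <-|uq].
  by rewrite ffunE.
by rewrite -{}xq -(kfunK i x) -kvec_proj !kvecK (negbTE uq).
Qed.

Lemma fapp_deg (C D : fcomplex A) (f : basis C -> basis D -> A) p q r c y :
  (forall x z, f x z != 0 -> deg z = deg x + r) -> q = p + r ->
  (forall x, c x != 0 -> deg x = p) -> fapp f c y != 0 -> deg y = q.
Proof.
move=> fr -> cp; apply: contra_neq_eq => yq; rewrite /fapp big1 // => x _.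
case: (eqVneq (c x) 0) => [->|/cp xp]; first by rewrite mul0r.
case: (eqVneq (f x y) 0) => [->|/fr]; first by rewrite mulr0.
by rewrite xp => yE; rewrite yE eqxx in yq.
Qed.

Lemma deg_ext (C : fcomplex A) q (f g : basis C -> A) :
  (forall x, f x != 0 -> deg x = q) -> (forall x, g x != 0 -> deg x = q) ->
  (forall x : {x : basis C | deg x == q}, f (val x) = g (val x)) -> f = g.
Proof.
move=> fq gq fg; apply/funext => x; have [xq|xq] := boolP (deg x == q).
  exact: fg (Sub x xq).
case: (eqVneq (f x) 0) => [->|/fq xE]; last by rewrite xE eqxx in xq.
by case: (eqVneq (g x) 0) => [->|/gq xE] //; rewrite xE eqxx in xq.
Qed.

Lemma cdiffE i p q s (c : cochain (koszul (seqX s i)) p) : q = p + 1 ->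
  kvec (cext (cdiff q c)) = kd i (kvec (cext c)).
Proof.
move=> qp; rewrite -kvec_diff; congr kvec; apply: (deg_ext (q := q)).
- exact: cext_deg.
- by move=> y; apply: (fapp_deg _ qp) (@cext_deg _ _ c); apply: diff_deg.
- by move=> y; rewrite cext_val cdiff_cext.
Qed.

Lemma cmapE i j (ij : (i <= j)%N) q s (c : cochain (koszul (seqX s j)) q) :
  kvec (cext (cmap (koszul_mu s ij) c)) = kmu (j - i) (kvec (cext c)).
Proof.
rewrite -kvec_mu; congr kvec; apply: (deg_ext (q := q)).
- exact: cext_deg.
- move=> y; apply: (@fapp_deg _ _ _ q q 0) (@cext_deg _ _ c); rewrite ?addr0 //.
  by move=> x z; rewrite addr0; apply: hcoef_deg.
- by move=> y; rewrite cext_val cmap_cext.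
Qed.

Lemma kvec_cext_inj i q s :
  injective (fun c : cochain (koszul (seqX s i)) q => kvec (cext c)).
Proof.
move=> c d /(congr1 (@kfun i s)); rewrite !kvecK => cd.
by apply/ffunP => x; rewrite -!cext_val cd.
Qed.

Lemma weakly_proregular_seqE s : weakly_proregular_seq s <-> kwpr s.
Proof.
have kfunP i q (x : kmod A (size s)) : kproj q x = x ->
    exists c : cochain (koszul (seqX s i)) q, kvec (cext c) = x.
  move=> xq; exists [ffun u => kfun x (val u)].
  by rewrite (cext_kfun i xq) kfunK.
have cext0 i q : kvec (cext (0 : cochain (koszul (seqX s i)) q)) = 0.
  rewrite -[RHS](kvec0 i s); congr kvec; apply/funext => x.
  by rewrite /cext; case: insubP => // u _ _; rewrite ffunE.
split=> ws q => [i q0|q0 i].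
- have [j [ij /cohomology_map0P H]] := ws q q0 i.
  (* The transition map of the model sees only the difference of the exponents. *)
  exists (j - i)%N => x xq; rewrite subnKC // => dx.
  have [c cE] := kfunP j q x xq.
  have [|b bE] := H c.
    by apply: (@kvec_cext_inj j); rewrite cdiffE // cE dx cext0.
  by exists (kvec (cext b)); rewrite -cE -cmapE -bE cdiffE // subrK.
- have [k kP] := ws q i q0; exists (i + k)%N, (leq_addr k i).
  apply/cohomology_map0P => c c0.
  have [||e eP] := kP (kvec (cext c)).
  + exact: kproj_cext.
  + by rewrite -(@cdiffE _ _ (q + 1)) // c0 cext0.
  (* Only a primitive concentrated in degree [q - 1] comes from a cochain of that degree. *)
  have [|e' e'q e'P] := @kd_preim_homog _ i (q - 1) s _ e _ eP.
    by rewrite subrK -kmu_kproj kproj_cext.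
  have [b bE] := kfunP i (q - 1) e' e'q; exists b.
  apply: (@kvec_cext_inj i); rewrite cdiffE ?subrK // bE e'P cmapE.
  by rewrite addKn.
Qed.

End Bridge.

(** * Localization *)

Section BaseChange.
Variables (A B : comPzRingType) (f : {rmorphism A -> B}).
Implicit Types (s : seq A) (i k : nat) (q : int).

Fixpoint kmap s : kmod A (size s) -> kmod B (size (map f s)) :=
  match s return kmod A (size s) -> kmod B (size (map f s)) with
  | [::] => f
  | a :: s' => fun x => (kmap x.1, kmap x.2)
  end.

Lemma kmap_is_zmod_morphism s : zmod_morphism (@kmap s).
Proof.
elim: s => [|a s IHs] /=; first exact: rmorphB.
by move=> [x y] [x' y'] /=; rewrite !IHs.
Qed.

HB.instance Definition _ s :=
  GRing.isZmodMorphism.Build _ _ (@kmap s) (@kmap_is_zmod_morphism s).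

Lemma kmapZ s a (x : kmod A (size s)) : kmap (a *: x) = f a *: kmap x.
Proof.
elim: s x => [|b s IHs] /=; first exact: rmorphM.
by move=> [x y] /=; rewrite !IHs.
Qed.

Lemma kmap_kd i s (x : kmod A (size s)) : kmap (kd i x) = kd i (kmap x).
Proof.
elim: s x => [|a s IHs] x /=; first exact: rmorph0.
by rewrite raddfN raddfD /= kmapZ !IHs rmorphXn.
Qed.

Lemma kmap_kmu k s (x : kmod A (size s)) : kmap (kmu k x) = kmu k (kmap x).
Proof.
by elim: s x => [|a s IHs] x //=; rewrite kmapZ !IHs rmorphXn.
Qed.

Lemma kmap_kproj q s (x : kmod A (size s)) :
  kmap (kproj q x) = kproj q (kmap x).
Proof.
elim: s q x => [|a s IHs] q x /=; last by rewrite !IHs.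
by case: ifP => // _; exact: rmorph0.
Qed.

End BaseChange.

Section LocalizationModel.
Variables (A : comPzRingType) (t : A).
Implicit Types (s : seq A) (i k : nat) (q : int) (I : set A).

Local Notation f := (to_loc t : {rmorphism A -> loc t}).

Lemma loc_denom (z : loc t) : exists n a, to_loc t (t ^+ n) * z = to_loc t a.
Proof.
elim/quotW: z => -[a m]; exists m, a.
rewrite /to_loc -[LHS]loc_pi_mul; apply/eqP/loc_eqP; exists 0%N => /=.
by rewrite !expr0 mulr1 add0n [t ^+ m * a]mulrC.
Qed.

Lemma to_loc_eq0 a : to_loc t a = 0 -> exists n, t ^+ n * a = 0.
Proof.
move=> a0.
have /eqP/loc_eqP[n /= nP] : \pi_(loc t) (a, 0%N) = \pi_(loc t) (0, 0%N).
  exact: a0.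
by exists n; move: nP; rewrite expr0 !mulr1 mulr0.
Qed.

Lemma to_loc_unit : exists u, u * to_loc t t = 1.
Proof.
exists (\pi_(loc t) (1, 1%N)); rewrite /to_loc -[LHS]loc_pi_mul.
by apply/eqP/loc_eqP; exists 0%N => /=; rewrite mulr1.
Qed.

Lemma kmap_denom s (z : kmod (loc t) (size (map f s))) :
  exists n x, to_loc t (t ^+ n) *: z = kmap f x.
Proof.
elim: s z => [|a s IHs] /=; first exact: loc_denom.
move=> [z w]; have [[m [x xP]] [n [y yP]]] := (IHs z, IHs w).
exists (m + n)%N, (t ^+ n *: x, t ^+ m *: y).
rewrite kmod_pairZ /= !kmapZ -xP -yP !scalerA -!rmorphM /= -!exprD.
by rewrite [(n + m)%N]addnC.
Qed.

Lemma kmap_eq0 s (x : kmod A (size s)) :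
  kmap f x = 0 -> exists n, t ^+ n *: x = 0.
Proof.
elim: s x => [|a s IHs] /=; first exact: to_loc_eq0.
move=> [x y] [/IHs[m xP] /IHs[n yP]]; exists (m + n)%N.
rewrite kmod_pairZ exprD -!scalerA yP scaler0 scalerA mulrC -scalerA xP.
by rewrite scaler0.
Qed.

(** The same [k] works: a cocycle times a power of [t] lifts to a cocycle over [A], and the image of
    its primitive is divided by that power. *)
Lemma kwpr_loc s : kwpr s -> kwpr (map f s).
Proof.
move=> ws q i q0; have [k kP] := ws q i q0; exists k => c cq dc.
have [n [x xP]] := kmap_denom c.
have [|m mP] := @kmap_eq0 s (kd (i + k) x).
  by rewrite kmap_kd -xP linearZ /= dc scaler0.
(* The lift is homogeneous only after localization, so it is projected to degree [q]. *)
have [||e eP] := kP (kproj q (t ^+ m *: x)); first exact: kprojK.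
  by rewrite kd_kproj linearZ /= mP linear0.
have [u uP] := to_loc_unit; exists (u ^+ (m + n) *: kmap f e).
rewrite linearZ /= -kmap_kd eP kmap_kmu kmap_kproj kmapZ -xP !linearZ /= cq.
by rewrite !scalerA !rmorphXn /= -exprD -exprMn mulrC uP expr1n scale1r.
Qed.

(** Denominators of the primitive are cleared first; the resulting equation holds over [A] up to a
    further power of [t]. *)
Lemma loc_coboundary_clear s i k (c : kmod A (size s)) :
    (exists e, kd i e = kmu k (kmap f c)) ->
  exists n e, kd i e = t ^+ n *: kmu k c.
Proof.
move=> [e eP]; have [m [x xP]] := kmap_denom e.
have [|n nP] := @kmap_eq0 s (kd i x - t ^+ m *: kmu k c).
  by rewrite raddfB /= kmap_kd kmapZ kmap_kmu -xP linearZ /= eP subrr.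
exists (n + m)%N, (t ^+ n *: x); apply/eqP.
by rewrite -subr_eq0 linearZ /= exprD -scalerA -scalerBr nP.
Qed.

Lemma to_loc_ideal_gen s y :
    ideal_gen [set` map f s]%classic (to_loc t y) ->
  exists n, ideal_gen [set` s]%classic (t ^+ n * y).
Proof.
(* The fractions that have a numerator in the ideal generated by [s]. *)
pose J : set (loc t) := fun z => exists n y,
  ideal_gen [set` s]%classic y /\ to_loc t (t ^+ n) * z = to_loc t y.
have [S0 SD SM] := ideal_gen_ideal [set` s]%classic.
have Ji : is_ideal J.
  split=> [|z w [m [y1 [y1s y1P]]] [n [y2 [y2s y2P]]]|z w [n [y1 [y1s y1P]]]].
  - by exists 0%N, 0; rewrite mulr0 rmorph0.
  - exists (m + n)%N, (t ^+ n * y1 + t ^+ m * y2); split.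
      by apply: (SD); apply: (SM).
    rewrite rmorphD !rmorphM /= -y1P -y2P exprD rmorphM /= mulrDr.
    by rewrite mulrA [X in X * z]mulrC !mulrA.
  - have [m [a aP]] := loc_denom z; exists (m + n)%N, (a * y1).
    by split; [apply: (SM)|rewrite rmorphM /= -y1P -aP exprD rmorphM /= mulrACA].
move=> /(ideal_gen_min Ji) [|n [y' [y's]]].
  move=> _ /mapP[z zs ->]; exists 0%N, z; rewrite rmorph1 mul1r; split=> //.
  exact: ideal_gen_sub.
rewrite -rmorphM => /eqP; rewrite -subr_eq0 -rmorphB => /eqP/to_loc_eq0[m].
move/eqP; rewrite mulrBr subr_eq0 mulrA -exprD => /eqP yE.
by exists (m + n)%N; rewrite yE; apply: (SM).
Qed.

Lemma loc_ideal_gen s :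
  loc_ideal t (ideal_gen [set` s]%classic) = ideal_gen [set` map f s]%classic.
Proof.
apply/seteqP; split; apply: ideal_gen_min; try exact: ideal_gen_ideal.
  move=> _ [y ys <-]; have [S0 SD SM] := ideal_gen_ideal [set` map f s]%classic.
  pose J : set A := fun y => ideal_gen [set` map f s]%classic (to_loc t y).
  suff: J y by []; move: y ys; apply: ideal_gen_min => [|z zs].
    rewrite /J; split=> [|a b Ja Jb|a b Jb]; first by rewrite rmorph0.
      by rewrite rmorphD; apply: SD.
    by rewrite rmorphM; apply: SM.
  by apply: ideal_gen_sub; apply: map_f.
move=> _ /mapP[y ys ->]; apply: ideal_gen_sub; exists y => //.
exact: ideal_gen_sub.
Qed.

Lemma weakly_proregular_loc I :
  weakly_proregular I -> weakly_proregular (loc_ideal t I).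
Proof.
move=> [s [/weakly_proregular_seqE sw ->]]; exists (map f s); split.
  exact/weakly_proregular_seqE/kwpr_loc.
exact: loc_ideal_gen.
Qed.

(** Each generator in [s] is a finite combination of images of elements of [I]; [b] collects those
    elements. *)
Lemma loc_ideal_fg I (s : seq (loc t)) :
    loc_ideal t I = ideal_gen [set` s]%classic ->
  exists b : seq A, (forall y, y \in b -> I y) /\
    forall z, loc_ideal t I z -> ideal_gen [set` map f b]%classic z.
Proof.
move=> IE.
suff [b [bI bs]] : exists b : seq A, (forall y, y \in b -> I y) /\
    forall z, z \in s -> ideal_gen [set` map f b]%classic z.
  exists b; split=> // z; rewrite IE; apply: ideal_gen_min bs _.
  exact: ideal_gen_ideal.
have : forall z, z \in s -> loc_ideal t I z.
  by move=> z zs; rewrite IE; exact: ideal_gen_sub.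
elim: s {IE} => [_|z s IHs sI]; first by exists [::].
have [|b [bI bs]] := IHs; first by move=> w ws; apply: sI; rewrite inE ws orbT.
have [|n [c [y [yI zE]]]] := sI z; first by rewrite inE eqxx.
have /choice[g gP] : forall i : 'I_n, exists a, I a /\ to_loc t a = y i.
  by move=> i; have [a Ia <-] := yI i; exists a.
have [S0 SD SM] := ideal_gen_ideal [set` map f (map g (enum 'I_n) ++ b)]%classic.
exists (map g (enum 'I_n) ++ b); split=> [a|w].
  by rewrite mem_cat => /orP[/mapP[i _ ->]|/bI //]; case: (gP i).
rewrite inE => /orP[/eqP ->|/bs].
  rewrite zE; elim/big_ind: _ => // i _; apply: (SM); apply: ideal_gen_sub => /=.
  by rewrite -(gP i).2 map_f // mem_cat map_f // mem_enum.
apply: ideal_gen_min => // a /mapP[a' a'b ->]; apply: ideal_gen_sub.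
by apply: map_f; rewrite mem_cat a'b orbT.
Qed.

End LocalizationModel.

(** * Descent along a covering sequence *)

Section Covering.
Variable A : comPzRingType.
Implicit Types (s b : seq A) (I : set A).

Lemma covering_fg I s : is_ideal I -> covering_sequence s ->
    (forall x, x \in s -> weakly_proregular (loc_ideal x I)) ->
  exists b, I = ideal_gen [set` b]%classic.
Proof.
move=> Ii sc sI.
have [b [bI bs]] : exists b, (forall y, y \in b -> I y) /\ forall x, x \in s ->
    forall z, loc_ideal x I z -> ideal_gen [set` map (to_loc x) b]%classic z.
  elim: s {sc} sI => [_|x s IHs sI]; first by exists [::].
  have [|b [bI bs]] := IHs; first by move=> y ys; apply: sI; rewrite inE ys orbT.
  have [|a [_ /loc_ideal_fg[b' [b'I b's]]]] := sI x; first by rewrite inE eqxx.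
  have mono t (u v : seq A) : {subset u <= v} ->
      forall z, ideal_gen [set` map (to_loc t) u]%classic z ->
        ideal_gen [set` map (to_loc t) v]%classic z.
    move=> uv; apply: ideal_gen_min; first exact: ideal_gen_ideal.
    by move=> _ /mapP[y /uv yv ->]; apply/ideal_gen_sub/map_f.
  exists (b' ++ b); split=> [y|y].
    by rewrite mem_cat => /orP[/b'I|/bI].
  rewrite inE => /predU1P[->|ys] z zI.
    by apply: mono (b's z zI) => w wb; rewrite mem_cat wb.
  by apply: mono (bs y ys z zI) => w wb; rewrite mem_cat wb orbT.
exists b; apply/seteqP; split=> [y Iy|]; last exact: ideal_gen_min.
have [S0 SD SM] := ideal_gen_ideal [set` b]%classic.
rewrite -[y]mul1r.
(* The conductor of [y] into the ideal generated by [b] contains a power of each member of [s],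
   hence 1. *)
apply: (@covering_ideal _ s (fun t => ideal_gen [set` b]%classic (t * y))) => //.
  split=> [|u v Ju Jv|u v Jv]; first by rewrite mul0r.
    by rewrite mulrDl; apply: SD.
  by rewrite -mulrA; apply: SM.
move=> x xs; apply: to_loc_ideal_gen; apply: bs => //.
by apply: ideal_gen_sub; exists y.
Qed.

Lemma kwpr_covering s b : covering_sequence s ->
  (forall x, x \in s -> kwpr (map (to_loc x) b)) -> kwpr b.
Proof.
move=> sc sb q i q0.
have [k kP] : exists k, forall x, x \in s -> forall c : kmod A (size b),
    kproj q c = c -> kd (i + k) c = 0 ->
    exists n e, kd i e = x ^+ n *: kmu k c.
  elim: s {sc} sb => [_|x s IHs sb]; first by exists 0%N.
  have [|k kP] := IHs; first by move=> y ys; apply: sb; rewrite inE ys orbT.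
  have [|l lP] := sb x _ q i q0; first by rewrite inE eqxx.
  (* For [x] the transition by [k] is made first and then [l] applies; for the other members, the
     reverse. *)
  exists (k + l)%N => y + c cq dc; rewrite inE => /predU1P[->|ys].
    have [||e eP] := lP (kmap (to_loc x) (kmu k c)).
    - by rewrite -kmap_kproj -kmu_kproj cq.
    - rewrite -kmap_kd; have -> : kd (i + l) (kmu k c) = 0.
        by apply: kmu_cocycle; rewrite -addnA [(l + k)%N]addnC.
      exact: raddf0.
    rewrite addnC kmuD; apply: loc_coboundary_clear; by exists e.
  rewrite kmuD; apply: kP => //; first by rewrite -kmu_kproj cq.
  by apply: kmu_cocycle; rewrite -addnA.
exists k => c cq dc; rewrite -[kmu k c]scale1r.
(* The multipliers making [kmu k c] a coboundary form an ideal; 1 belongs to it. *)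
apply: (@covering_ideal _ s (fun t => exists e, kd i e = t *: kmu k c)) => //.
  split=> [|u v [e eP] [e' e'P]|u v [e eP]].
  - by exists 0; rewrite linear0 scale0r.
  - by exists (e + e'); rewrite linearD /= eP e'P scalerDl.
  - by exists (u *: e); rewrite linearZ /= eP scalerA.
by move=> x xs; apply: kP.
Qed.

End Covering.

Theorem theorem0p6 (A : comPzRingType) (I : set A) (hI : is_ideal I) :
  weakly_proregular I <->
  (exists s : seq A, covering_sequence s /\
     (forall x : A, x \in s -> weakly_proregular (loc_ideal x I))).
Proof.
split=> [wI|[s [sc sI]]].
  (* The covering by 1 suffices, since weak proregularity passes to every localization. *)
  exists [:: 1]; split=> [|x _]; last exact: weakly_proregular_loc.
  apply/seteqP; split=> // x _; rewrite -[x]mulr1.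
  have [_ _ SM] := ideal_gen_ideal [set` [:: 1 : A]]%classic.
  by apply/SM/ideal_gen_sub; rewrite /= inE.
have [b IE] := covering_fg hI sc sI; exists b; split=> //.
apply/weakly_proregular_seqE/(kwpr_covering sc) => x xs.
(* Over the localization at [x], the given sequence [a] and the image of [b] generate the same
   ideal. *)
have [a [/weakly_proregular_seqE aw aE]] := sI x xs.
by apply: kwpr_ideal aw; rewrite -aE IE loc_ideal_gen.
Qed.
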